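(* Let $f:L\rightarrow M$ be an open localic map that sends dense elements of $L$ to dense elements of $M$. (1) $f$ preserves weakly homogeneous maximal nowhere dense sublocales: if $F$ is a weakly homogeneous maximal nowhere dense sublocale of $L$, then $f[F]$ is a weakly homogeneous maximal nowhere dense sublocale of $M$. (2) If $f$ is injective, then $f$ reflects both weakly homogeneous maximal nowhere dense and homogeneous maximal nowhere dense sublocales: if $K$ is a weakly homogeneous (resp. homogeneous) maximal nowhere dense sublocale of $M$, then $f_{-1}[K]$ is a weakly homogeneous (resp. homogeneous) maximal nowhere dense sublocale of $L$.
   Context: A localic map $f:L\to M$ is an infimum-preserving map between locales whose left adjoint $f^*:M\to L$ preserves finite meets. For a sublocale $S$ of $L$, the set-theoretic image $f[S]$ is a sublocale of $M$; for a sublocale $T$ of $M$, $f_{-1}[T]$ is the join (equivalently the largest) of all sublocales of $L$ contained in $f^{-1}(T)$. $f$ is open if $f[S]$ is an open sublocale of $M$ for every open sublocale $S$ of $L$. An element $a$ of a locale is dense if $a\to 0=0$. $\mathsf{O}=\{1\}$ is the void sublocale. A sublocale $N$ of $L$ is nowhere dense if $N\cap\mathfrak{B}L=\mathsf{O}$, where $\mathfrak{B}L=\{x\to 0:x\in L\}$. For a sublocale $S$ of $L$, ''$N$ is nowhere dense in $S$'' means $N\subseteq S$ and $N$ is a nowhere dense sublocale of the locale $S$. A nowhere dense sublocale $N$ of $L$ is maximal nowhere dense if there is no nowhere dense sublocale $S$ of $L$ such that $N$ is nowhere dense in $S$. A regular-closed sublocale of a locale is the closure of some open sublocale. A nowhere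 dense sublocale $N$ of $L$ is weakly homogeneous maximal nowhere dense if each non-void regular-closed sublocale of the locale $N$ is maximal nowhere dense in $L$; it is homogeneous maximal nowhere dense if, in addition, $N$ is closed in $L$. *)

(* Defs.v *)
From HB Require Import structures.
From mathcomp Require Import all_boot all_order.
From mathcomp Require Import boolp classical_sets.

Set Implicit Arguments.
Unset Strict Implicit.
Unset Printing Implicit Defensive.

Import Order.LTheory.

Local Open Scope classical_set_scope.
Local Open Scope order_scope.

HB.mixin Record TBLattice_isLocale (d : Order.disp_t) (T : Type)
    of Order.TBLattice d T := {
  lsup : set T -> T ;
  lsup_ub : forall (A : set T) (a : T), A a -> a <= lsup A ;
  lsup_le : forall (A : set T) (b : T),
    (forall a, A a -> a <= b) -> lsup A <= b ;
  meet_lsup : forall (x : T) (A : set T),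
    x `&` lsup A = lsup [set x `&` a | a in A]
}.

#[short(type="localeType")]
HB.structure Definition Locale (d : Order.disp_t) :=
  { T of TBLattice_isLocale d T & Order.TBLattice d T }.

Section LocaleOps.
Context {d : Order.disp_t} {L : localeType d}.
Implicit Types (x y z a b : L) (A : set L).

Definition linf A : L := lsup [set x | forall a, A a -> x <= a].

Definition himp a b : L := lsup [set x | x `&` a <= b].

Definition dense_elt a : Prop := himp a \bot = \bot.

Lemma linf_lb A a : A a -> linf A <= a.
Proof. by move=> Aa; apply: lsup_le => x; apply. Qed.

Lemma le_linf A b : (forall a, A a -> b <= a) -> b <= linf A.
Proof. by move=> h; apply: lsup_ub. Qed.

Lemma le_himp x a b : (x <= himp a b) = (x `&` a <= b).
Proof.
apply/idP/idP => [h|h]; last exact: lsup_ub.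
have /le_trans : x `&` a <= himp a b `&` a by rewrite leI2.
apply; rewrite meetC meet_lsup; apply: lsup_le => _ [y /= yab <-].
by rewrite meetC.
Qed.

Lemma himp_linf x A : himp x (linf A) = linf [set himp x a | a in A].
Proof.
apply/le_anti/andP; split.
  apply: le_linf => _ [a Aa <-]; rewrite le_himp.
  by rewrite (le_trans _ (linf_lb Aa)) // -le_himp.
rewrite le_himp; apply: le_linf => a Aa; rewrite -le_himp.
by apply: linf_lb; exists a.
Qed.

Lemma himp_idem a b : himp a (himp a b) = himp a b.
Proof.
apply/le_anti/andP; split; rewrite le_himp; last by rewrite leIl.
have -> : himp a (himp a b) `&` a = himp a (himp a b) `&` a `&` a.
  by rewrite -meetA meetxx.
by rewrite -!le_himp.
Qed.

End LocaleOps.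

Definition booleanization (d : Order.disp_t) (L : localeType d) : set L :=
  [set himp x \bot | x in [set: L]].
Arguments booleanization {d} L _.

Record sublocale (d : Order.disp_t) (L : localeType d) := Sublocale {
  sl_set :> set L ;
  sl_linf : forall A : set L, A `<=` sl_set -> sl_set (linf A) ;
  sl_himp : forall x s : L, sl_set s -> sl_set (himp x s)
}.

(** A sublocale, with the induced order, is itself a locale. *)

Definition locale_of (d : Order.disp_t) (L : localeType d) (S : sublocale L)
  : Type := {x : L | x \in (S : set L)}.

Section LocaleOf.
Context {d : Order.disp_t} {L : localeType d} {S : sublocale L}.

HB.instance Definition _ := [isSub of locale_of S for @sval _ _].
HB.instance Definition _ := [Choice of locale_of S by <:].
HB.instance Definition _ := [SubChoice_isSubPOrder of locale_of S by <: with d].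

Definition to_locale_of (x : L) (Sx : sl_set S x) : locale_of S :=
  exist _ x (mem_set Sx).

Lemma locale_ofP (x : locale_of S) : sl_set S (val x).
Proof. exact: set_mem (valP x). Qed.

Lemma locale_of_leE (x y : locale_of S) : (x <= y) = (val x <= val y).
Proof. by []. Qed.

Lemma sl_top : sl_set S \top.
Proof.
have <- : linf set0 = \top :> L by apply/le_anti; rewrite lex1 le_linf.
exact: sl_linf.
Qed.

Lemma sl_meet x y : sl_set S x -> sl_set S y -> sl_set S (x `&` y).
Proof.
move=> Sx Sy; have -> : x `&` y = linf [set z | z = x \/ z = y].
  apply/le_anti/andP; split.
    by apply: le_linf => _ [->|->]; rewrite ?leIl ?leIr.
  by rewrite lexI !linf_lb //; [right|left].
by apply: sl_linf => _ [->|->].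
Qed.

Definition sl_lsup (A : set (locale_of S)) : L :=
  linf [set s | sl_set S s /\ forall a, A a -> val a <= s].

Lemma sl_lsupP A : sl_set S (sl_lsup A).
Proof. by apply: sl_linf => s []. Qed.

Definition sub_lsup A : locale_of S := to_locale_of (sl_lsupP A).

Lemma sub_lsup_ub (A : set (locale_of S)) a : A a -> a <= sub_lsup A.
Proof.
by move=> Aa; rewrite locale_of_leE; apply: le_linf => s [_]; apply.
Qed.

Lemma sub_lsup_le (A : set (locale_of S)) b :
  (forall a, A a -> a <= b) -> sub_lsup A <= b.
Proof.
by move=> h; rewrite locale_of_leE; apply: linf_lb; split=> //; exact: locale_ofP.
Qed.

Definition sub_meet (x y : locale_of S) : locale_of S :=
  to_locale_of (sl_meet (locale_ofP x) (locale_ofP y)).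

Definition sub_join (x y : locale_of S) : locale_of S :=
  sub_lsup [set z | z = x \/ z = y].

Lemma sub_lexI (x y z : locale_of S) :
  (x <= sub_meet y z) = (x <= y) && (x <= z).
Proof. by rewrite !locale_of_leE lexI. Qed.

Lemma sub_leUx (x y z : locale_of S) :
  (sub_join x y <= z) = (x <= z) && (y <= z).
Proof.
apply/idP/andP => [h|[xz yz]]; last by apply: sub_lsup_le => _ [->|->].
by split; apply: (le_trans _ h); apply: sub_lsup_ub; [left|right].
Qed.

Lemma sub_le0x (x : locale_of S) : sub_lsup set0 <= x.
Proof. exact: sub_lsup_le. Qed.

Lemma sub_lex1 (x : locale_of S) : x <= to_locale_of sl_top.
Proof. by rewrite locale_of_leE lex1. Qed.

HB.instance Definition _ :=
  Order.POrder_isMeetSemilattice.Build d (locale_of S) sub_lexI.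
HB.instance Definition _ :=
  Order.POrder_isJoinSemilattice.Build d (locale_of S) sub_leUx.
HB.instance Definition _ := Order.hasBottom.Build d (locale_of S) sub_le0x.
HB.instance Definition _ := Order.hasTop.Build d (locale_of S) sub_lex1.

Lemma sub_meet_lsup (x : locale_of S) (A : set (locale_of S)) :
  x `&` sub_lsup A = sub_lsup [set x `&` a | a in A].
Proof.
apply/le_anti/andP; split; last first.
  apply: sub_lsup_le => _ [a Aa <-].
  by rewrite leI2 ?lexx //; apply: sub_lsup_ub.
rewrite locale_of_leE; apply: le_linf => s [Ss hs].
change (val x `&` sl_lsup A <= s); rewrite meetC -le_himp.
apply: linf_lb; split; first exact: sl_himp.
by move=> a Aa; rewrite le_himp meetC; apply: (hs (x `&` a)); exists a.
Qed.

HB.instance Definition _ := TBLattice_isLocale.Build d (locale_of S)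
  sub_lsup_ub sub_lsup_le sub_meet_lsup.

Lemma val_linf (A : set (locale_of S)) : val (linf A) = linf (val @` A).
Proof.
have SA : sl_set S (linf (val @` A)).
  by apply: sl_linf => _ [a _ <-]; exact: locale_ofP.
apply/le_anti/andP; split.
  by apply: le_linf => _ [a Aa <-]; rewrite -locale_of_leE linf_lb.
have : to_locale_of SA <= linf A; last by [].
by apply: le_linf => a Aa; rewrite locale_of_leE; apply: linf_lb; exists a.
Qed.

Lemma val_himp (x y : locale_of S) : val (himp x y) = himp (val x) (val y).
Proof.
have Sh : sl_set S (himp (val x) (val y)) by apply: sl_himp; exact: locale_ofP.
apply/le_anti/andP; split.
  rewrite le_himp.
  have : himp x y `&` x <= y by rewrite -le_himp.
  by [].
have : to_locale_of Sh <= himp x y; last by [].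
rewrite le_himp locale_of_leE.
change (himp (val x) (val y) `&` val x <= val y).
by rewrite -le_himp.
Qed.

End LocaleOf.

Section SublocaleConstructions.
Context {d : Order.disp_t} {L : localeType d}.

(** [embed_sublocale R] is a sublocale [R] of the locale [N], seen in [L]. *)

Section Embed.
Variables (N : sublocale L) (R : sublocale (locale_of N)).

Fact embed_linf (A : set L) :
  A `<=` val @` R -> (val @` (R : set (locale_of N))) (linf A).
Proof.
move=> AR; exists (linf [set x | sl_set R x /\ A (val x)]).
  by apply: sl_linf => x [].
rewrite val_linf; congr linf; apply/seteqP; split => [_ [x [_ Ax] <-]//|x Ax].
by case: (AR _ Ax) => y Ry yx; exists y => //; split=> //; rewrite yx.
Qed.

Fact embed_himp (x s : L) : (val @` (R : set (locale_of N))) s ->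
  (val @` (R : set (locale_of N))) (himp x s).
Proof.
move=> [y Ry <-].
have Nxy : sl_set N (himp x (val y)) by apply: sl_himp; exact: locale_ofP.
have NA : sl_set N (linf [set s | sl_set N s /\ x <= s]) by apply: sl_linf => ? [].
exists (himp (to_locale_of NA) y); first exact: sl_himp.
rewrite val_himp; change (himp (linf [set s | sl_set N s /\ x <= s]) (val y) =
  himp x (val y)).
apply/le_anti/andP; split; rewrite le_himp.
  have /le_trans : himp (linf [set s0 | sl_set N s0 /\ x <= s0]) (val y) `&` x <=
    himp (linf [set s0 | sl_set N s0 /\ x <= s0]) (val y) `&`
      linf [set s0 | sl_set N s0 /\ x <= s0].
    by rewrite leI2 ?lexx //; apply: le_linf => ? [].
  by apply; rewrite -le_himp.
rewrite meetC -le_himp; apply: linf_lb; split.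
  by apply: sl_himp; exact: locale_ofP.
by rewrite le_himp meetC -le_himp.
Qed.

Definition embed_sublocale : sublocale L := Sublocale embed_linf embed_himp.

End Embed.

(** [restrict_sublocale S N] is [N], seen as a sublocale of the locale [S]
    (of interest when [N `<=` S]). *)

Section Restrict.
Variables S N : sublocale L.

Fact restrict_linf (A : set (locale_of S)) :
  A `<=` [set x | sl_set N (val x)] -> sl_set N (val (linf A)).
Proof.
by move=> AN; rewrite val_linf; apply: sl_linf => _ [a Aa <-]; exact: AN.
Qed.

Fact restrict_himp (x s : locale_of S) : sl_set N (val s) -> sl_set N (val (himp x s)).
Proof. by move=> Ns; rewrite val_himp; exact: sl_himp. Qed.

Definition restrict_sublocale : sublocale (locale_of S) :=
  @Sublocale _ (locale_of S) [set x : locale_of S | sl_set N (val x)]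
    restrict_linf restrict_himp.

End Restrict.

Section Join.
Variable C : set (sublocale L).

Definition join_set : set L :=
  [set linf A | A in [set A : set L | A `<=` \bigcup_(S in C) (S : set L)]].

Fact join_linf (A : set L) : A `<=` join_set -> join_set (linf A).
Proof.
move=> AJ; exists [set x | (\bigcup_(S in C) (S : set L)) x /\
  exists2 a, A a & a <= x]; first by move=> x [].
apply/le_anti/andP; split; last first.
  by apply: le_linf => x [_ [a Aa ax]]; apply: le_trans ax; exact: linf_lb.
apply: le_linf => a Aa; have [B BC Ba] := AJ _ Aa.
rewrite -Ba; apply: le_linf => b Bb; apply: linf_lb; split; first exact: BC.
by exists a => //; rewrite -Ba; exact: linf_lb.
Qed.

Fact join_himp (x s : L) : join_set s -> join_set (himp x s).
Proof.
move=> [A AC <-]; exists [set himp x a | a in A]; last by rewrite himp_linf.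
by move=> _ [a /AC [S CS Sa] <-]; exists S => //; exact: sl_himp.
Qed.

Definition join_sublocale : sublocale L := Sublocale join_linf join_himp.

End Join.

Section OpenClosed.
Variable a : L.

Fact open_linf (A : set L) :
  A `<=` range (himp a) -> range (himp a) (linf A).
Proof.
move=> Aa; exists (linf A) => //; rewrite himp_linf; congr linf.
have fixA x : A x -> himp a x = x by move=> /Aa[y _ <-]; exact: himp_idem.
apply/seteqP; split => [_ [x Ax <-]|x Ax]; first by rewrite fixA.
by exists x; rewrite ?fixA.
Qed.

Fact open_himp (x s : L) : range (himp a) s -> range (himp a) (himp x s).
Proof.
move=> [y _ <-]; exists (himp x y) => //.
by apply/le_anti/andP; split; rewrite !le_himp meetAC -!le_himp.
Qed.

Definition open_sublocale : sublocale L := Sublocale open_linf open_himp.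

Fact closed_linf (A : set L) : A `<=` [set x | a <= x] -> a <= linf A.
Proof. by move=> h; exact: le_linf. Qed.

Fact closed_himp (x s : L) : a <= s -> a <= himp x s.
Proof. by move=> h; rewrite le_himp (le_trans _ h) // leIl. Qed.

Definition closed_sublocale : sublocale L :=
  @Sublocale _ _ [set x | a <= x] closed_linf closed_himp.

End OpenClosed.

Definition is_open (S : sublocale L) : Prop :=
  exists a : L, S = open_sublocale a :> set L.

Definition is_closed (S : sublocale L) : Prop :=
  exists a : L, S = closed_sublocale a :> set L.

(** The closure of [S], i.e. the least closed sublocale containing [S], is the
    up-set of the infimum of [S]: see [sl_closure_least]. *)
Definition sl_closure (S : sublocale L) : sublocale L :=
  closed_sublocale (linf S).

Lemma sub_sl_closure (S : sublocale L) : S `<=` sl_closure S.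
Proof. by move=> x; exact: linf_lb. Qed.

Lemma sl_closure_least (S T : sublocale L) :
  is_closed T -> S `<=` T -> sl_closure S `<=` T.
Proof.
move=> [a ->] ST x /=; apply: le_trans; apply: le_linf => s Ss; exact: ST.
Qed.

Definition is_void (S : sublocale L) : Prop := S = [set \top] :> set L.

Definition regular_closed (S : sublocale L) : Prop :=
  exists2 U : sublocale L, is_open U & S = sl_closure U :> set L.

Definition nowhere_dense (N : sublocale L) : Prop :=
  (N `&` booleanization L)%classic = [set \top].

End SublocaleConstructions.

Section MaximalNowhereDense.
Context {d : Order.disp_t} {L : localeType d}.
Implicit Types N S : sublocale L.

Definition nowhere_dense_in N S : Prop :=
  N `<=` S /\ nowhere_dense (restrict_sublocale S N).

Definition maximal_nowhere_dense N : Prop :=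
  nowhere_dense N /\
  ~ exists S : sublocale L, nowhere_dense S /\ nowhere_dense_in N S.

Definition weakly_homogeneous_mnd N : Prop :=
  nowhere_dense N /\
  forall R : sublocale (locale_of N), regular_closed R -> ~ is_void R ->
    maximal_nowhere_dense (embed_sublocale R).

Definition homogeneous_mnd N : Prop :=
  weakly_homogeneous_mnd N /\ is_closed N.

End MaximalNowhereDense.

(** The left adjoint [lm_adj] is a field for convenience: it is determined by
    the underlying map. *)
Record localicMap (dL dM : Order.disp_t) (L : localeType dL)
    (M : localeType dM) := LocalicMap {
  lm_fun :> L -> M ;
  lm_linf : forall A : set L, lm_fun (linf A) = linf (lm_fun @` A) ;
  lm_adj : M -> L ;
  lm_adjP : forall (y : M) (x : L), (lm_adj y <= x) = (y <= lm_fun x) ;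
  lm_adj_top : lm_adj \top = \top ;
  lm_adj_meet : forall y z : M, lm_adj (y `&` z) = lm_adj y `&` lm_adj z
}.

Section Images.
Context {dL dM : Order.disp_t} {L : localeType dL} {M : localeType dM}.
Variable f : localicMap L M.

Section Image.
Variable S : sublocale L.

Fact image_linf (A : set M) : A `<=` f @` S -> (f @` (S : set L)) (linf A).
Proof.
move=> AS; exists (linf [set x | sl_set S x /\ A (f x)]).
  by apply: sl_linf => x [].
rewrite lm_linf; congr linf; apply/seteqP; split => [_ [x [_ Ax] <-]//|y Ay].
by have [x Sx xy] := AS _ Ay; exists x => //; split=> //; rewrite xy.
Qed.

Fact image_himp (y s : M) : (f @` (S : set L)) s ->
  (f @` (S : set L)) (himp y s).
Proof.
move=> [x Sx <-]; exists (himp (lm_adj f y) x); first exact: sl_himp.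
have E z : (z <= f (himp (lm_adj f y) x)) = (z <= himp y (f x)).
  by rewrite -lm_adjP !le_himp -lm_adj_meet lm_adjP.
by apply/le_anti/andP; split; [rewrite -E|rewrite E].
Qed.

Definition image_sublocale : sublocale M := Sublocale image_linf image_himp.

End Image.

Definition preimage_sublocale (T : sublocale M) : sublocale L :=
  join_sublocale [set S : sublocale L | S `<=` f @^-1` T].

Lemma preimage_sublocale_sub (T : sublocale M) :
  preimage_sublocale T `<=` f @^-1` T.
Proof.
move=> _ [A AC <-] /=; rewrite lm_linf; apply: sl_linf => _ [a Aa <-].
by have [S ST Sa] := AC _ Aa; exact: ST.
Qed.

Lemma preimage_sublocale_largest (T : sublocale M) (S : sublocale L) :
  S `<=` f @^-1` T -> S `<=` preimage_sublocale T.
Proof.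
move=> ST x Sx; exists [set x]; first by move=> _ ->; exists S.
by apply/le_anti; rewrite linf_lb //= le_linf // => _ ->.
Qed.

Definition open_localic_map : Prop :=
  forall S : sublocale L, is_open S -> is_open (image_sublocale S).

End Images.

(* Main.v *)
(** Every notion involved depends on a sublocale [N] only through its least
    element [n = linf N]: [N] is nowhere dense iff [n] is dense; maximal nowhere
    dense iff moreover no dense [s <= n] satisfies [n -> s = s]; and weakly
    homogeneous iff each [a -> n] different from [1] has this maximality property.
    Openness of [f] makes the left adjoint [f^*] preserve the Heyting implication,
    hence also density, so that a witness of non-maximality can be carried along
    [f^*] for (1) and along [f] for (2). *)

Require Import Defs.
From mathcomp Require Import all_boot all_order.
From mathcomp Require Import boolp classical_sets.

Set Implicit Arguments.
Unset Strict Implicit.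
Unset Printing Implicit Defensive.

Import Order.LTheory.

Local Open Scope classical_set_scope.
Local Open Scope order_scope.

(** * Heyting implication and density in a locale *)

Section LocaleTheory.
Context {d : Order.disp_t} {L : localeType d}.
Implicit Types (x y z a b n s : L) (N S : sublocale L).

Lemma himp_top_le a b : (himp a b = \top) <-> a <= b.
Proof.
split=> [h|ab]; first by rewrite -[a]meet1x -le_himp h.
by apply/le_anti; rewrite lex1 le_himp meet1x.
Qed.

Lemma himpAC a b x : himp a (himp b x) = himp (a `&` b) x.
Proof.
apply/le_anti/andP; split; first by rewrite le_himp meetA -!le_himp.
by rewrite !le_himp -meetA -le_himp.
Qed.

Lemma le_himp2 a b x y : b <= a -> x <= y -> himp a x <= himp b y.
Proof.
move=> ba xy; rewrite le_himp; apply: le_trans xy.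
by apply: le_trans (leI2 (lexx _) ba) _; rewrite -le_himp.
Qed.

Lemma himp_ge a b : b <= himp a b.
Proof. by rewrite le_himp leIl. Qed.

Lemma dense_elt_le a b : a <= b -> dense_elt a -> dense_elt b.
Proof. by move=> ab da; apply/le_anti; rewrite le0x -[X in _ <= X]da le_himp2. Qed.

Lemma sl_linf_mem S : sl_set S (linf S).
Proof. exact: sl_linf. Qed.

Lemma linf_least (A : set L) a : A a -> (forall x, A x -> a <= x) -> linf A = a.
Proof. by move=> Aa h; apply/le_anti; rewrite linf_lb ?le_linf. Qed.

Lemma linf_closed a : linf (closed_sublocale a) = a.
Proof. by apply: linf_least => //=. Qed.

Lemma linf_open a : linf (open_sublocale a) = himp a \bot.
Proof.
apply: linf_least; first by exists \bot.
by move=> _ [y _ <-]; rewrite le_himp2.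
Qed.

(** Elements of the form [himp p s] lie in [N], so they are above [a] as soon as they are above the
    least element of [N] over [a]. This turns an arbitrary [a : L] into an element of the locale
    [N]. *)
Lemma himp_sl_hull N a s : sl_set N s ->
  himp (linf [set x | sl_set N x /\ a <= x]) s = himp a s.
Proof.
move=> Ns; apply/le_anti/andP; split.
  by rewrite le_himp2 //; apply: le_linf => x [].
rewrite le_himp meetC -le_himp; apply: linf_lb; split; first exact: sl_himp.
by rewrite le_himp meetC -le_himp.
Qed.

(* If [n] is the least element of [N], then [n** = n* -> n] lies in [N]. *)
Lemma nowhere_denseP N : nowhere_dense N <-> dense_elt (linf N).
Proof.
set n := linf N; split=> [h|dn].
  have nn : himp (himp n \bot) n = himp (himp n \bot) \bot.
    apply/le_anti/andP; split; last by rewrite le_himp2.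
    rewrite le_himp; set p := himp (himp n \bot) n.
    have pn : p `&` himp n \bot <= n by rewrite -le_himp.
    have pp : p `&` himp n \bot <= himp n \bot `&` n by rewrite lexI leIr.
    by apply: le_trans pp _; rewrite -le_himp.
  have : (N `&` booleanization L)%classic (himp (himp n \bot) n).
    split; first by apply: sl_himp; exact: sl_linf_mem.
    by exists (himp n \bot); rewrite ?nn.
  rewrite h /= nn => /himp_top_le h0.
  by apply/le_anti; rewrite h0 le0x.
apply/seteqP; split=> [y [Ny [x _ yE]]|_ ->]; last first.
  split; first exact: sl_top.
  by exists \bot => //; apply/himp_top_le.
rewrite /= -yE; apply/himp_top_le.
by rewrite -dn le_himp meetC -le_himp yE; exact: linf_lb.
Qed.

(** The equation [himp n s = s] expresses that [n] is dense in the up-set of [s], a locale with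
    bottom [s]. *)
Definition maximal_dense n : Prop :=
  dense_elt n /\ ~ exists s, [/\ dense_elt s, s <= n & himp n s = s].

End LocaleTheory.

(** * Sublocale notions expressed by least elements *)

Section SublocaleTheory.
Context {d : Order.disp_t} {L : localeType d}.
Implicit Types (a : L) (N S : sublocale L).

Lemma val_bot S : val (\bot : locale_of S) = linf S.
Proof.
apply/le_anti/andP; split; last by apply: linf_lb; exact: locale_ofP.
exact: (le0x (to_locale_of (sl_linf_mem S))).
Qed.

Lemma val_top S : val (\top : locale_of S) = \top.
Proof. by []. Qed.

Lemma linf_embed N (R : sublocale (locale_of N)) :
  linf (embed_sublocale R) = val (linf R).
Proof. by rewrite val_linf. Qed.

Lemma nowhere_dense_inP N S :
  nowhere_dense_in N S <-> N `<=` S /\ himp (linf N) (linf S) = linf S.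
Proof.
have E : N `<=` S -> val (linf (restrict_sublocale S N)) = linf N.
  move=> NS; rewrite val_linf; congr linf.
  apply/seteqP; split=> [_ [x Nx <-]//|x Nx].
  by exists (to_locale_of (NS x Nx)).
split=> -[NS h]; split=> //.
  move/nowhere_denseP: h => /(congr1 val).
  by rewrite val_himp val_bot E.
by apply/nowhere_denseP/val_inj; rewrite val_himp val_bot E.
Qed.

(* A witness [S] may be replaced by its closure. *)
Lemma maximal_nowhere_denseP N :
  maximal_nowhere_dense N <-> maximal_dense (linf N).
Proof.
split=> -[/nowhere_denseP dn h]; split=> //.
  move=> [s [ds sn hs]]; apply: h; exists (closed_sublocale s); split.
    by apply/nowhere_denseP; rewrite linf_closed.
  apply/nowhere_dense_inP; rewrite linf_closed; split=> // x Nx /=.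
  exact: le_trans sn (linf_lb Nx).
move=> [S [/nowhere_denseP dS /nowhere_dense_inP[NS hS]]].
apply: h; exists (linf S); split=> //.
by apply: le_linf => x /NS; exact: linf_lb.
Qed.

(** A regular-closed sublocale of [N] is the up-set in [N] of a pseudocomplement taken in [N], that
    is, of some [himp a (linf N)]; it is void exactly when this element is the top. *)
Lemma weakly_homogeneous_mndP N : weakly_homogeneous_mnd N <->
  dense_elt (linf N) /\
  forall a, himp a (linf N) <> \top -> maximal_dense (himp a (linf N)).
Proof.
split=> -[/nowhere_denseP dn h]; split=> //.
  move=> a; rewrite -(himp_sl_hull a (sl_linf_mem N)).
  have Na : sl_set N (linf [set x | sl_set N x /\ a <= x]).
    by apply: sl_linf => x [].
  pose b := to_locale_of Na; rewrite -[linf [set _ | _]]/(val b) => nt.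
  pose R := sl_closure (open_sublocale b).
  have RE : val (linf R) = himp (val b) (linf N).
    by rewrite linf_closed linf_open val_himp val_bot.
  rewrite -RE -linf_embed; apply/maximal_nowhere_denseP/h.
    by exists (open_sublocale b) => //; exists b.
  move=> R1; apply: nt; rewrite -RE; have := sl_linf_mem R.
  by rewrite {1}R1 => ->.
move=> R [U [a Ua] RU] Rv; apply/maximal_nowhere_denseP.
have RE : linf R = himp a \bot by rewrite RU linf_closed Ua linf_open.
rewrite linf_embed RE val_himp val_bot; apply: h => nt.
apply: Rv; apply/seteqP; split=> [x Rx|_ ->]; last exact: sl_top.
apply/le_anti; rewrite lex1 (le_trans _ (linf_lb Rx)) // RE.
by rewrite locale_of_leE val_himp val_bot nt val_top.
Qed.

End SublocaleTheory.

(** * Localic maps, their adjoints, and openness *)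

Section LocalicMapTheory.
Context {dL dM : Order.disp_t} {L : localeType dL} {M : localeType dM}.
Variable f : localicMap L M.
Implicit Types (a b x : L) (u y z : M).

Lemma le_lm_fun x a : x <= a -> f x <= f a.
Proof.
by move=> xa; rewrite -lm_adjP; apply: le_trans xa; rewrite lm_adjP.
Qed.

Lemma lm_adj_unit y : y <= f (lm_adj f y).
Proof. by rewrite -lm_adjP. Qed.

Lemma lm_adj_counit x : lm_adj f (f x) <= x.
Proof. by rewrite lm_adjP. Qed.

(** Transposed along the adjunction, this is preservation of binary meets by [lm_adj f]. *)
Lemma lm_fun_himp y x : f (himp (lm_adj f y) x) = himp y (f x).
Proof.
have E z : (z <= f (himp (lm_adj f y) x)) = (z <= himp y (f x)).
  by rewrite -lm_adjP !le_himp -lm_adj_meet lm_adjP.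
by apply/le_anti/andP; split; [rewrite -E|rewrite E].
Qed.

Lemma lm_fun_top : f \top = \top.
Proof. by apply/le_anti; rewrite lex1 -lm_adjP lex1. Qed.

Lemma lm_adj_bot : lm_adj f \bot = \bot.
Proof. by apply/le_anti; rewrite le0x lm_adjP le0x. Qed.

(** Each side is the least element above [y] in the common sublocale f[o(a)] = o(u). *)
Lemma lm_fun_himp_open a u :
  image_sublocale f (open_sublocale a) = open_sublocale u :> set M ->
  forall y, f (himp a (lm_adj f y)) = himp u y.
Proof.
move=> E y; apply/le_anti/andP; split.
  have : (image_sublocale f (open_sublocale a) : set M) (himp u y).
    by rewrite E; exists y.
  move=> [_ [x _ <-] fx]; rewrite -fx; apply: le_lm_fun.
  rewrite -(himp_idem a x) le_himp2 // lm_adjP fx; exact: himp_ge.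
have : (open_sublocale u : set M) (f (himp a (lm_adj f y))).
  by rewrite -E; exists (himp a (lm_adj f y)) => //; exists (lm_adj f y).
move=> [v _ vE]; rewrite -vE -(himp_idem u v) le_himp2 // vE.
by rewrite (le_trans (lm_adj_unit y)) // le_lm_fun // himp_ge.
Qed.

(* With [f[o(a)] = o(u)], the assignment [a |-> u] is left adjoint to [f^*], and
   it satisfies the Frobenius identity. *)
Lemma lm_adj_himp : open_localic_map f ->
  forall y z, lm_adj f (himp y z) = himp (lm_adj f y) (lm_adj f z).
Proof.
move=> fo y z; apply/le_anti/andP; split.
  by rewrite le_himp -lm_adj_meet lm_adjP (le_trans _ (lm_adj_unit z)) // -le_himp.
set a := himp _ _.
have [|u E] := fo (open_sublocale a); first by exists a.
have {}E := lm_fun_himp_open E.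
have uyz : u <= himp y z.
  rewrite le_himp meetC -le_himp -E -lm_adjP le_himp meetC.
  by rewrite -le_himp.
(* By [E], [f] sends [himp a (lm_adj f (himp y z))] to [himp u (himp y z)], which is the top by
   [uyz]; the adjunction brings this back to [L]. *)
apply/himp_top_le; apply/le_anti; rewrite lex1 -(lm_adj_top f) lm_adjP E.
by rewrite le_himp meet1x.
Qed.

Lemma lm_adj_dense : open_localic_map f ->
  forall y, dense_elt y -> dense_elt (lm_adj f y).
Proof.
by move=> fo y dy; rewrite /dense_elt -lm_adj_bot -lm_adj_himp // dy.
Qed.

Lemma linf_image (S : sublocale L) : linf (image_sublocale f S) = f (linf S).
Proof. by rewrite lm_linf. Qed.

Lemma maximal_dense_image (f_open : open_localic_map f)
    (f_dense : forall a, dense_elt a -> dense_elt (f a)) a :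
  maximal_dense a -> maximal_dense (f a).
Proof.
move=> [da h]; split; first exact: f_dense.
move=> [s [ds sa hs]]; apply: h; exists (lm_adj f s); split.
- exact: lm_adj_dense.
- by rewrite lm_adjP.
(* Since [lm_adj f (f a) <= a], implication from [a] lies below implication from [lm_adj f (f a)],
   and the latter is computed in [M]. *)
- apply/le_anti; rewrite himp_ge andbT -{2}hs lm_adj_himp //.
  by rewrite le_himp2 // lm_adj_counit.
Qed.

(** * Injective maps and preimages *)

Section Injective.
Hypothesis f_inj : injective f.

Lemma lm_funK x : lm_adj f (f x) = x.
Proof.
apply: f_inj; apply/le_anti; rewrite lm_adj_unit andbT.
exact/le_lm_fun/lm_adj_counit.
Qed.

Lemma lm_fun_himp_inj a x : f (himp a x) = himp (f a) (f x).
Proof. by rewrite -lm_fun_himp lm_funK. Qed.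

Lemma maximal_dense_reflect
    (f_dense : forall a, dense_elt a -> dense_elt (f a)) a :
  dense_elt a -> maximal_dense (f a) -> maximal_dense a.
Proof.
move=> da [_ h]; split=> // -[s [ds sa hs]]; apply: h; exists (f s); split.
- exact: f_dense.
- exact: le_lm_fun.
- by rewrite -lm_fun_himp_inj hs.
Qed.

(** The image of all of [L] is an open sublocale o(u), and the composite of [lm_adj f] followed by
    [f] is its nucleus. *)
Lemma lm_fun_adj_open : open_localic_map f ->
  exists u, forall y, f (lm_adj f y) = himp u y.
Proof.
move=> fo; have [|u E] := fo (open_sublocale \top); first by exists \top.
exists u => y; rewrite -(lm_fun_himp_open E); congr (f _).
by apply/le_anti/andP; split; [exact: himp_ge|rewrite -[himp _ _]meetx1 -le_himp].
Qed.

(** An injective [f] preserves implication as well as infima, so the set-theoretic preimage is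
    itself a sublocale. *)
Lemma preimage_sublocale_inj (K : sublocale M) :
  preimage_sublocale f K = f @^-1` K :> set L.
Proof.
apply/seteqP; split; first exact: preimage_sublocale_sub.
have hl (A : set L) : A `<=` f @^-1` K -> (f @^-1` K) (linf A).
  by move=> AK; rewrite /= lm_linf; apply: sl_linf => _ [x Ax <-]; exact: AK.
have hh (x s : L) : (f @^-1` K) s -> (f @^-1` K) (himp x s).
  by move=> Ks; rewrite /= lm_fun_himp_inj; exact: sl_himp.
exact: (@preimage_sublocale_largest _ _ _ _ f K (Sublocale hl hh)).
Qed.

(** Openness puts [lm_adj f (linf K)] in the preimage: [f] maps it to [himp u (linf K)], an element
    of [K]. *)
Lemma linf_preimage (K : sublocale M) : open_localic_map f ->
  linf (preimage_sublocale f K) = lm_adj f (linf K).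
Proof.
move=> /lm_fun_adj_open[u uE]; rewrite preimage_sublocale_inj.
apply: linf_least => [|x Kx].
  by rewrite /= uE; apply: sl_himp; exact: sl_linf_mem.
by rewrite lm_adjP; exact: linf_lb.
Qed.

Lemma weakly_homogeneous_mnd_preimage (f_open : open_localic_map f)
    (f_dense : forall a, dense_elt a -> dense_elt (f a)) (K : sublocale M) :
  weakly_homogeneous_mnd K -> weakly_homogeneous_mnd (preimage_sublocale f K).
Proof.
move=> /weakly_homogeneous_mndP[dk h]; apply/weakly_homogeneous_mndP.
rewrite linf_preimage //; set k := linf K in dk h *.
have dt := lm_adj_dense f_open dk; split=> // a nt.
have [u uE] := lm_fun_adj_open f_open.
(* The image again has the form of an implication into [k], so the hypothesis on [K] applies to
   it. *)
have fE : f (himp a (lm_adj f k)) = himp (f a `&` u) k.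
  by rewrite lm_fun_himp_inj uE himpAC.
apply: maximal_dense_reflect => //; first by apply: dense_elt_le dt; exact: himp_ge.
rewrite fE; apply: h; rewrite -fE => ft; apply: nt.
by apply: f_inj; rewrite ft lm_fun_top.
Qed.

Lemma is_closed_preimage (K : sublocale M) :
  is_closed K -> is_closed (preimage_sublocale f K).
Proof.
move=> [k Kk]; exists (lm_adj f k); rewrite preimage_sublocale_inj Kk.
by apply/seteqP; split=> x /=; rewrite lm_adjP.
Qed.

End Injective.

Lemma weakly_homogeneous_mnd_image (f_open : open_localic_map f)
    (f_dense : forall a, dense_elt a -> dense_elt (f a)) (F : sublocale L) :
  weakly_homogeneous_mnd F -> weakly_homogeneous_mnd (image_sublocale f F).
Proof.
move=> /weakly_homogeneous_mndP[dc h]; apply/weakly_homogeneous_mndP.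
rewrite linf_image; split; first exact: f_dense.
(* The implication from [u] is the image of the one from [lm_adj f u], where the hypothesis on [F]
   applies. *)
move=> u; rewrite -lm_fun_himp => nt; apply: maximal_dense_image => //.
by apply: h => ht; apply: nt; rewrite ht lm_fun_top.
Qed.

End LocalicMapTheory.

Theorem proposition6p5 (dL dM : Order.disp_t) (L : localeType dL)
    (M : localeType dM) (f : localicMap L M)
    (f_open : open_localic_map f)
    (f_dense : forall a : L, dense_elt a -> dense_elt (f a)) :
  (forall F : sublocale L,
     weakly_homogeneous_mnd F -> weakly_homogeneous_mnd (image_sublocale f F))
  /\
  (injective f ->
     (forall K : sublocale M,
        weakly_homogeneous_mnd K ->
        weakly_homogeneous_mnd (preimage_sublocale f K))
     /\
     (forall K : sublocale M,
        homogeneous_mnd K -> homogeneous_mnd (preimage_sublocale f K))).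
Proof.
split; first exact: weakly_homogeneous_mnd_image.
move=> f_inj; have h := weakly_homogeneous_mnd_preimage f_inj f_open f_dense.
split=> // K [/h hK cK]; split=> //; exact: is_closed_preimage.
Qed.
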